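(* Let $R$ be a one-dimensional Noetherian domain, $I$ an ideal of $R$, $M$ a finitely generated $R$-module, and let $F$ be a functor arising from a middle finite complex $A\xrightarrow{\alpha}B\xrightarrow{\beta}C$. Then the sequence of sets $\{\operatorname{Ass}_R F(M/I^nM)\}_{n\ge1}$ is eventually constant.
   Context: For a complex $\mathcal{E}\colon A\to B\to C$ of $R$-modules, the functor arising from $\mathcal{E}$ is the $R$-linear functor $F$ on all $R$-modules given by $F(X)=H(\mathcal{E}\otimes_R X)$, the homology at the middle term of $A\otimes X\to B\otimes X\to C\otimes X$. The complex is middle finite if $B$ is finitely generated ($A$ and $C$ arbitrary). *)

(* Defs.v *)
From HB Require Import structures.
From mathcomp Require Import all_boot all_order all_algebra.
Set Implicit Arguments. Unset Strict Implicit. Unset Printing Implicit Defensive.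
Import GRing.Theory.
Local Open Scope ring_scope.

Section CommAlg.
Variable R : comNzRingType.

Definition is_ideal (I : R -> Prop) : Prop :=
  I 0 /\ (forall x y, I x -> I y -> I (x + y)) /\ (forall r x, I x -> I (r * x)).

Definition prime_ideal (P : R -> Prop) : Prop :=
  is_ideal P /\ ~ P 1 /\ (forall a b, P (a * b) -> P a \/ P b).

Definition ideal_fg (I : R -> Prop) : Prop :=
  exists n (g : 'I_n -> R), (forall i, I (g i)) /\
    forall x, I x -> exists c : 'I_n -> R, x = \sum_(i < n) c i * g i.

Definition noetherian_ring : Prop := forall I, is_ideal I -> ideal_fg I.

Definition pstrict (P Q : R -> Prop) : Prop :=
  (forall x, P x -> Q x) /\ exists x, Q x /\ ~ P x.

Definition krull_dim_one : Prop :=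
  (exists P Q, prime_ideal P /\ prime_ideal Q /\ pstrict P Q) /\
  ~ (exists P Q S, prime_ideal P /\ prime_ideal Q /\ prime_ideal S /\
                   pstrict P Q /\ pstrict Q S).

Definition module_fg (M : lmodType R) : Prop :=
  exists n (g : 'I_n -> M), forall m, exists c : 'I_n -> R,
    m = \sum_(i < n) c i *: g i.

Definition ideal_pow_smul (I : R -> Prop) (n : nat) (M : lmodType R) (m : M) : Prop :=
  exists k (a : 'I_k -> 'I_n -> R) (v : 'I_k -> M),
    (forall j l, I (a j l)) /\ m = \sum_(j < k) (\prod_(l < n) a j l) *: v j.

(* Tensor products A ⊗_R (X/N), N a submodule of X given as a predicate.
   An element of A ⊗ (X/N) is a finite sum  sum_i a_i ⊗ [x_i], represented by
   the list of pairs (a_i, x_i).  Such a sum is zero iff it is killed by every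
   R-bilinear map A x (X/N) -> W, i.e. every R-bilinear map A x X -> W
   vanishing on A x N. *)
Definition bilin_van (A X : lmodType R) (N : X -> Prop) (W : lmodType R)
  (phi : A -> X -> W) : Prop :=
  (forall a a' x, phi (a + a') x = phi a x + phi a' x) /\
  (forall a x x', phi a (x + x') = phi a x + phi a x') /\
  (forall r a x, phi (r *: a) x = r *: phi a x) /\
  (forall r a x, phi a (r *: x) = r *: phi a x) /\
  (forall a x, N x -> phi a x = 0).

Definition tensor_zero (A X : lmodType R) (N : X -> Prop) (s : seq (A * X)) : Prop :=
  forall (W : lmodType R) (phi : A -> X -> W), bilin_van N phi ->
    \sum_(p <- s) phi p.1 p.2 = 0.

Definition tmap (A B X : lmodType R) (f : A -> B) (s : seq (A * X)) : seq (B * X) :=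
  map (fun p => (f p.1, p.2)) s.

Definition tscale (A X : lmodType R) (r : R) (s : seq (A * X)) : seq (A * X) :=
  map (fun p => (r *: p.1, p.2)) s.

Definition tsub (A X : lmodType R) (s t : seq (A * X)) : seq (A * X) :=
  s ++ map (fun p => (- p.1, p.2)) t.

(* F(X/N) = H(A ⊗ X/N -> B ⊗ X/N -> C ⊗ X/N).  A cycle z (element of
   ker(beta ⊗ 1)) represents a class of F(X/N); r annihilates that class iff
   r z lies in im(alpha ⊗ 1). *)
Definition is_cycle (B C X : lmodType R) (be : B -> C) (N : X -> Prop)
  (z : seq (B * X)) : Prop := tensor_zero N (tmap be z).

Definition hom_ann (A B X : lmodType R) (al : A -> B) (N : X -> Prop)
  (z : seq (B * X)) (r : R) : Prop :=
  exists w : seq (A * X), tensor_zero N (tsub (tscale r z) (tmap al w)).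

Definition Ass_F (A B C X : lmodType R) (al : A -> B) (be : B -> C)
  (N : X -> Prop) (P : R -> Prop) : Prop :=
  prime_ideal P /\
  exists z : seq (B * X), is_cycle be N z /\ forall r, P r <-> hom_ann al N z r.

End CommAlg.

(* Main.v *)
(** Let [B] and [M] be generated by [p] and [q] elements, and let [G] be the free module of
    [p] x [q] matrices, which maps onto [B ⊗ M].  Let [K] be the kernel of
    [G -> coker al ⊗ M] and let [W n] consist of the matrices that become cycles modulo
    [I^n M].  Right exactness of the tensor product gives
    [F (M / I^n M) = W n / (K + I^n G)], and all that is needed of [C] is that [W] is a
    decreasing filtration with [I W n <= W n.+1].

    Let [I] be nonzero and let [T] be the [I]-power torsion of [G] modulo [K].  It has finite
    length modulo [K], so [T ∩ W n] is a constant [Z] for large [n], and it meets [I^n G] only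
    in [K].  The Hilbert basis theorem for the Rees ring gives
    [(I^n.+1 G + Z : I) <= I^n G + (Z : I)] for large [n].  Suppose that [P] is the annihilator
    of the class of [u] in [W n / (K + I^n G)]; it is a maximal ideal.  Either some multiple of
    [u] outside of [P] lies in [I^n G + Z], and [P] is associated to [Z / K], hence to all later
    quotients; or some [a u] with [a] in [I] stays nonzero in the next quotient, and its
    annihilator is again [P].  So the sets of associated primes eventually increase, inside the
    finite set of primes containing [I]. *)
Require Import Defs.
From HB Require Import structures.
From mathcomp Require Import all_boot all_order all_algebra.
From mathcomp Require Import boolp zify.
Set Implicit Arguments. Unset Strict Implicit. Unset Printing Implicit Defensive.
Import GRing.Theory.
Local Open Scope ring_scope.

(** * Submodules, finite generation and quotient modules *)

Lemma seq_bound (T : eqType) (s : seq T) (Q : nat -> T -> Prop) :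
  (forall n k x, (n <= k)%N -> Q n x -> Q k x) ->
  (forall x, x \in s -> exists n, Q n x) -> exists n, forall x, x \in s -> Q n x.
Proof.
move=> hQ; elim: s => [|g s IHs] hs; first by exists 0%N.
have [n hn] := IHs (fun x hx => hs x (@mem_behead _ (g :: s) x hx)).
have [k hk] := hs g (mem_head _ _).
exists (maxn n k) => x; rewrite inE => /orP [/eqP -> | /hn hx].
  by apply: hQ hk; exact: leq_maxr.
by apply: hQ hx; exact: leq_maxl.
Qed.


Section Submodules.
Variable R : comNzRingType.
Implicit Type M : lmodType R.

Definition submod M (N : M -> Prop) : Prop :=
  N 0 /\ (forall x y, N x -> N y -> N (x + y)) /\ (forall r x, N x -> N (r *: x)).

Lemma submod0 M (N : M -> Prop) : submod N -> N 0.
Proof. by case. Qed.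

Lemma submodD M (N : M -> Prop) x y : submod N -> N x -> N y -> N (x + y).
Proof. by case=> _ [h _]; exact: h. Qed.

Lemma submodZ M (N : M -> Prop) r x : submod N -> N x -> N (r *: x).
Proof. by case=> _ [_ h]; exact: h. Qed.

Lemma submodN M (N : M -> Prop) x : submod N -> N x -> N (- x).
Proof. by move=> hN hx; rewrite -scaleN1r; exact: submodZ. Qed.

Lemma submodB M (N : M -> Prop) x y : submod N -> N x -> N y -> N (x - y).
Proof. by move=> hN hx hy; apply: submodD => //; exact: submodN. Qed.

Lemma submod_sum M (N : M -> Prop) (J : Type) (s : seq J) (P : pred J) (F : J -> M) :
  submod N -> (forall j, P j -> N (F j)) -> N (\sum_(j <- s | P j) F j).
Proof.
by move=> hN hF; apply: big_ind => //; [exact: submod0 | move=> x y; exact: submodD].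
Qed.

Definition subadd M (A B : M -> Prop) (m : M) : Prop :=
  exists a b, A a /\ B b /\ m = a + b.

Lemma submod_add M (A B : M -> Prop) : submod A -> submod B -> submod (subadd A B).
Proof.
move=> hA hB; split; first by exists 0, 0; rewrite addr0; do !split; exact: submod0.
split=> [_ _ [a [b [ha [hb ->]]]] [a' [b' [ha' [hb' ->]]]] | r _ [a [b [ha [hb ->]]]]].
  by exists (a + a'), (b + b'); rewrite addrACA; do !split; exact: submodD.
by exists (r *: a), (r *: b); rewrite scalerDr; do !split; exact: submodZ.
Qed.

Lemma subaddl M (A B : M -> Prop) x : submod B -> A x -> subadd A B x.
Proof. by move=> hB hx; exists x, 0; rewrite addr0; do !split=> //; exact: submod0. Qed.

Lemma subaddr M (A B : M -> Prop) x : submod A -> B x -> subadd A B x.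
Proof. by move=> hA hx; exists 0, x; rewrite add0r; do !split=> //; exact: submod0. Qed.

Lemma subadd_min M (A B N : M -> Prop) : submod N ->
  (forall x, A x -> N x) -> (forall x, B x -> N x) -> forall x, subadd A B x -> N x.
Proof.
by move=> hN hA hB _ [a [b [/hA ha [/hB hb ->]]]]; exact: submodD.
Qed.

Lemma submod_cap M (A B : M -> Prop) : submod A -> submod B ->
  submod (fun m => A m /\ B m).
Proof.
move=> hA hB; split; first by split; exact: submod0.
by split=> [x y [? ?] [? ?] | r x [? ?]]; split; (exact: submodD || exact: submodZ).
Qed.

Lemma submod_colon M (N : M -> Prop) (x : R) : submod N -> submod (fun m => N (x *: m)).
Proof.
move=> hN; split; first by rewrite scaler0; exact: submod0.
split=> [y z hy hz | r y hy]; first by rewrite scalerDr; exact: submodD.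
by rewrite scalerA mulrC -scalerA; exact: submodZ.
Qed.

Lemma submod_bigcap M (J : Type) (Q : J -> Prop) (N : J -> M -> Prop) :
  (forall j, Q j -> submod (N j)) -> submod (fun m => forall j, Q j -> N j m).
Proof.
move=> hN; split=> [j /hN/submod0 // | ].
split=> [y z hy hz j hj | r y hy j hj].
  by apply: submodD; [exact: hN | exact: hy | exact: hz].
by apply: submodZ; [exact: hN | exact: hy].
Qed.

Lemma submod_line M (t : M) : submod (fun m => exists r, m = r *: t).
Proof.
split; first by exists 0; rewrite scale0r.
split=> [_ _ [r ->] [s ->] | r _ [s ->]]; first by exists (r + s); rewrite scalerDl.
by exists (r * s); rewrite scalerA.
Qed.

Lemma ideal_colon M (N : M -> Prop) (t : M) : submod N -> is_ideal (fun r => N (r *: t)).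
Proof.
move=> hN; split; first by rewrite scale0r; exact: submod0.
split=> [y z hy hz | r y hy]; first by rewrite scalerDl; exact: submodD.
by rewrite -scalerA; exact: submodZ.
Qed.

(** The impredicative form turns an induction over the span into the choice of a submodule that
    contains the generators. *)
Definition spanned M (P : M -> Prop) (m : M) : Prop :=
  forall N, submod N -> (forall x, P x -> N x) -> N m.

Lemma submod_spanned M (P : M -> Prop) : submod (spanned P).
Proof.
split=> [N /submod0 // | ].
split=> [x y hx hy N hN h | r x hx N hN h].
  by apply: submodD => //; [exact: hx | exact: hy].
by apply: submodZ => //; exact: hx.
Qed.

Lemma mem_spanned M (P : M -> Prop) x : P x -> spanned P x.
Proof. by move=> hx N hN; exact. Qed.

Lemma spanned_sub M (P Q : M -> Prop) : (forall x, P x -> Q x) ->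
  forall x, spanned P x -> spanned Q x.
Proof. by move=> PQ x hx N hN hQ; apply: hx => // y /PQ; exact: hQ. Qed.

Lemma spanned_cons M (g : M) (s : seq M) m : spanned (fun x => x \in g :: s) m ->
  exists c y, spanned (fun x => x \in s) y /\ m = c *: g + y.
Proof.
move=> hm.
have hS := submod_add (submod_line g) (submod_spanned (fun x => x \in s)).
have [_ [y [[c ->] [hy ->]]]] : subadd (fun m => exists r, m = r *: g)
    (spanned (fun x => x \in s)) m.
  apply: hm => // x; rewrite inE => /orP [/eqP -> | hx].
    by apply: subaddl; [exact: submod_spanned | exists 1; rewrite scale1r].
  by apply: subaddr; [exact: submod_line | exact: mem_spanned].
by exists c, y.
Qed.

Definition fingen M (N : M -> Prop) : Prop :=
  exists s : seq M, (forall x, x \in s -> N x) /\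
    forall m, N m -> spanned (fun x => x \in s) m.

Lemma noetherian_fingen (J : R -> Prop) : noetherian_ring R -> is_ideal J ->
  fingen (M := R^o) J.
Proof.
move=> hR hJ; have [n [g [hg hs]]] := hR _ hJ.
exists [seq g i | i <- enum 'I_n]; split=> [_ /mapP [i _ ->] // | m /hs [c ->]].
move=> N hN hgN; apply: (@submod_sum R^o N) => // i _.
by apply: (submodZ (M := R^o)) => //; apply: hgN; apply: map_f; rewrite mem_enum.
Qed.

Lemma fingen_coord M (N : M -> Prop) : fingen N ->
  exists n (g : 'I_n -> M), (forall i, N (g i)) /\
    forall m, N m -> exists c : 'I_n -> R, m = \sum_(i < n) c i *: g i.
Proof.
move=> [s [hs hN]]; exists (size s), (fun i => s`_i); split=> [i | x hx].
  by apply: hs; rewrite mem_nth.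
apply: (hN _ hx (fun x => exists c : 'I_(size s) -> R, x = \sum_i c i *: s`_i)).
  split; first by exists (fun=> 0); rewrite big1 // => i _; rewrite scale0r.
  split=> [_ _ [c ->] [d ->] | r _ [c ->]].
    exists (fun i => c i + d i); rewrite -big_split /=.
    by apply: eq_bigr => i _; rewrite scalerDl.
  exists (fun i => r * c i); rewrite scaler_sumr.
  by apply: eq_bigr => i _; rewrite scalerA.
move=> y hy; have hi : (index y s < size s)%N by rewrite index_mem.
exists (fun i => (i == Ordinal hi)%:R); rewrite (bigD1 (Ordinal hi)) //= eqxx scale1r.
by rewrite nth_index // big1 ?addr0 // => i /negPf ->; rewrite scale0r.
Qed.

Lemma fingen_ideal_fg (J : R -> Prop) : fingen (M := R^o) J -> ideal_fg J.
Proof. exact: fingen_coord. Qed.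

(** Induction on the spanning list: the coefficients of [g] in elements of [N] form an ideal [J].
    Lifts of generators of [J], together with generators of the part of [N] inside the span of the
    tail, generate [N]. *)
Lemma fingen_sub_span M (s : seq M) (N : M -> Prop) : noetherian_ring R -> submod N ->
  (forall m, N m -> spanned (fun x => x \in s) m) -> fingen N.
Proof.
move=> hR; elim: s N => [|g s IHs] N hN hNs.
  by exists [::]; split.
have hs := submod_spanned (fun x => x \in s).
pose J c := exists y, spanned (fun x => x \in s) y /\ N (c *: g + y).
have hJ : is_ideal J.
  split; first by exists 0; rewrite scale0r addr0; split; exact: submod0.
  split=> [a b [y [hy hyN]] [z [hz hzN]] | r a [y [hy hyN]]].
    by exists (y + z); rewrite scalerDl addrACA; split; [exact: (submodD hs) | exact: submodD].
  by exists (r *: y); rewrite -scalerA -scalerDr; split; [exact: (submodZ _ hs) | exact: submodZ].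
have [t [htJ hJt]] := noetherian_fingen hR hJ.
have /choice [y hy] : forall c : R, exists y, J c ->
    spanned (fun x => x \in s) y /\ N (c *: g + y).
  move=> c; case: (EM (J c)) => [[y hy] | hc]; first by exists y.
  by exists 0.
have [u [huN hNu]] : fingen (fun m => N m /\ spanned (fun x => x \in s) m).
  by apply: IHs => [|m []//]; exact: submod_cap.
exists ([seq c *: g + y c | c <- t] ++ u); split.
  move=> x; rewrite mem_cat => /orP [/mapP [c /htJ /hy [] _ ? -> //] | /huN [] //].
move=> m hm; have [c [z [hz defm]]] := spanned_cons (hNs _ hm).
have hc : J c by exists z; rewrite -defm.
pose S := spanned (fun x => x \in [seq c *: g + y c | c <- t] ++ u).
have hS : submod S by exact: submod_spanned.
have hSN x : S x -> N x.
  apply; first exact: hN.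
  move=> w; rewrite mem_cat => /orP [/mapP [d /htJ /hy [] _ ? -> //] | /huN [] //].
(* The lifts produce an element of [S] with the same [g]-coefficient as [m]; the difference then
   lies in [N] and in the span of [s], where the induction hypothesis applies. *)
have [w [hw hwS]] : exists w, spanned (fun x => x \in s) w /\ S (c *: g + w).
  apply: (hJt _ hc (fun c => exists w, spanned (fun x => x \in s) w /\ S (c *: g + w))).
    split; first by exists 0; rewrite scale0r addr0; split; exact: submod0.
    split=> [a b [w [hw hwN]] [v [hv hvN]] | r a [w [hw hwN]]].
      exists (w + v); rewrite scalerDl addrACA.
      by split; [exact: (submodD hs) | exact: (submodD hS)].
    exists (r *: w); rewrite -scalerA -scalerDr.
    by split; [exact: (submodZ _ hs) | exact: (submodZ _ hS)].
  move=> d hd; exists (y d); split; first by have [] := hy _ (htJ _ hd).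
  by apply: mem_spanned; rewrite mem_cat (map_f (fun c => c *: g + y c)).
have -> : m = (c *: g + w) + (z - w).
  by rewrite defm addrACA subrr addr0.
apply: (submodD hS) => //; apply: spanned_sub (hNu _ _).
  by move=> x hx; rewrite mem_cat hx orbT.
split; last exact: (submodB hs).
have -> : z - w = m - (c *: g + w) by rewrite defm opprD addrACA subrr add0r.
by apply: (submodB hN) => //; exact: hSN.
Qed.

Definition noeth_module M : Prop := forall N : M -> Prop, submod N -> fingen N.

Lemma noeth_matrix p q : noetherian_ring R -> noeth_module 'M[R]_(p, q).
Proof.
move=> hR N hN.
pose s := [seq (delta_mx ij.1 ij.2 : 'M[R]_(p, q)) | ij : 'I_p * 'I_q].
apply: (@fingen_sub_span _ s) => // m _ S hS hsS; rewrite [m]matrix_sum_delta.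
apply: (submod_sum _ hS) => i _; apply: (submod_sum _ hS) => j _; apply: (submodZ _ hS).
by apply: hsS; apply/imageP; exists (i, j).
Qed.

Lemma noeth_module_gens M : noeth_module M ->
  exists n (g : 'I_n -> M), forall m, exists c : 'I_n -> R, m = \sum_(i < n) c i *: g i.
Proof.
move=> hM; have [n [g [_ hg]]] := fingen_coord (hM (fun=> True) ltac:(by [])).
by exists n, g => m; exact: hg.
Qed.

Lemma noetherian_regular : noetherian_ring R -> noeth_module R^o.
Proof. by move=> hR N hN; exact: noetherian_fingen. Qed.

(** Without a maximal member, choice gives a strictly increasing chain in [Q]. Its union is finitely
    generated, hence equal to some finite stage. *)
Lemma noeth_max M (Q : (M -> Prop) -> Prop) (N0 : M -> Prop) : noeth_module M ->
  (forall N, Q N -> submod N) -> Q N0 ->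
  exists N, Q N /\ forall N', Q N' -> (forall m, N m -> N' m) -> forall m, N' m -> N m.
Proof.
move=> hM hQ hN0; apply: contrapT => hno.
have /choice [f hf] : forall N : M -> Prop, exists N' : M -> Prop, Q N ->
    [/\ Q N', forall m, N m -> N' m & exists m, N' m /\ ~ N m].
  move=> N; case: (EM (Q N)) => hN; last by exists N.
  apply: contrapT => hN'; apply: hno; exists N; split=> // N' QN' NN' m N'm.
  apply: contrapT => Nm; apply: hN'; exists N' => _; split=> //.
  by exists m.
pose c n := iter n f N0.
have hc n : Q (c n) by elim: n => //= n /hf [].
have cS n m : c n m -> c n.+1 m by have [_ h _] := hf _ (hc n); exact: h.
have cle n k m : (n <= k)%N -> c n m -> c k m.
  move=> /subnK <-; elim: (k - n)%N => // d IH /IH; exact: cS.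
pose U m := exists n, c n m.
have hU : submod U.
  split; first by exists 0%N; exact: submod0 (hQ _ hN0).
  split=> [x y [n hx] [k hy] | r x [n hx]]; last first.
    by exists n; apply: submodZ => //; exact: hQ.
  exists (maxn n k); apply: submodD; first exact: hQ.
    by apply: cle hx; exact: leq_maxl.
  by apply: cle hy; exact: leq_maxr.
have [s [hs hUs]] := hM _ hU.
have [n hn] := seq_bound cle hs.
have [_ _ [m [hm]]] := hf _ (hc n); apply.
by apply: (hUs m _ (c n)) => //; [exists n.+1 | exact: hQ].
Qed.

End Submodules.

Section QuotientModule.
Local Open Scope quotient_scope.
Variables (R : comNzRingType) (M : lmodType R) (N : M -> Prop) (hN : submod N).

Definition submod_pred : {pred M} := fun m => `[< N m >].

Lemma submod_zmod_closed : zmod_closed submod_pred.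
Proof.
split=> [|x y]; first by apply/asboolP; exact: submod0 hN.
by move=> /asboolP hx /asboolP hy; apply/asboolP; exact: submodB.
Qed.

HB.instance Definition _ := GRing.isZmodClosed.Build M submod_pred submod_zmod_closed.

(** [{ideal_quot _}] supplies the additive group only; the scalar action is added below through
    representatives. The quotient serves as the target of a test map in [boundary_mx_pow]. *)
Definition quotmod : Type := {ideal_quot submod_pred}.
HB.instance Definition _ := GRing.Zmodule.on quotmod.

Definition qclass (m : M) : quotmod := \pi_{ideal_quot submod_pred} m.

Lemma qclass_eq x y : qclass x = qclass y <-> N (x - y).
Proof.
split=> [/eqP | h]; first by rewrite -Quotient.idealrBE => /asboolP.
by apply/eqP; rewrite -Quotient.idealrBE; apply/asboolP.
Qed.

Lemma qclass_eq0 x : qclass x = 0 <-> N x.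
Proof.
have -> : 0 = qclass 0 by rewrite /qclass raddf0.
by rewrite qclass_eq subr0.
Qed.

Lemma qclassD x y : qclass (x + y) = qclass x + qclass y.
Proof. by rewrite /qclass raddfD. Qed.

Lemma qclass_sum (J : Type) (s : seq J) (F : J -> M) :
  qclass (\sum_(j <- s) F j) = \sum_(j <- s) qclass (F j).
Proof. by apply: (big_morph qclass) => [x y|]; [exact: qclassD | rewrite /qclass raddf0]. Qed.

Definition qscale (r : R) (u : quotmod) : quotmod :=
  qclass (r *: repr (u : {ideal_quot submod_pred})).

Lemma qclass_surj (u : quotmod) : exists x, u = qclass x.
Proof. by exists (repr (u : {ideal_quot submod_pred})); rewrite /qclass reprK. Qed.

Lemma qscaleE r x : qscale r (qclass x) = qclass (r *: x).
Proof.
apply/qclass_eq; rewrite -scalerBr; apply: submodZ => //; apply/qclass_eq.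
by rewrite /qclass reprK.
Qed.

Lemma qscaleA a b u : qscale a (qscale b u) = qscale (a * b) u.
Proof. by have [x ->] := qclass_surj u; rewrite !qscaleE scalerA. Qed.

Lemma qscale1 : left_id 1 qscale.
Proof. by move=> u; have [x ->] := qclass_surj u; rewrite qscaleE scale1r. Qed.

Lemma qscaleDr : right_distributive qscale +%R.
Proof.
move=> r u v; have [x ->] := qclass_surj u; have [y ->] := qclass_surj v.
by rewrite -qclassD !qscaleE scalerDr qclassD.
Qed.

Lemma qscaleDl u : {morph qscale^~ u : a b / a + b}.
Proof. by move=> a b; have [x ->] := qclass_surj u; rewrite !qscaleE scalerDl qclassD. Qed.

HB.instance Definition _ := GRing.Zmodule_isLmodule.Build R quotmod
  qscaleA qscale1 qscaleDr qscaleDl.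

Lemma qclassZ r x : qclass (r *: x) = r *: qclass x.
Proof. by rewrite -qscaleE. Qed.

End QuotientModule.

(** * Powers of ideals and the Hilbert basis theorem *)

Section IdealPowers.
Variables (R : comNzRingType) (I : R -> Prop).
Implicit Type M : lmodType R.

Lemma ideal_pow_submod M n : submod (@ideal_pow_smul R I n M).
Proof.
split; first by exists 0, (fun _ _ => 0), (fun=> 0); split=> [[] // | ]; rewrite big_ord0.
split=> [_ _ [k [a [v [ha ->]]]] [k' [a' [v' [ha' ->]]]] | r _ [k [a [v [ha ->]]]]].
  exists (k + k')%N, (fun j => match split j with inl i => a i | inr i => a' i end),
    (fun j => match split j with inl i => v i | inr i => v' i end); split.
    by move=> j l; case: (split j).
  rewrite big_split_ord /=; congr (_ + _); apply: eq_bigr => j _.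
    by have := unsplitK (inl _ j : 'I_k + 'I_k')%type => /= ->.
  by have := unsplitK (inr _ j : 'I_k + 'I_k')%type => /= ->.
exists k, a, (fun j => r *: v j); split=> //.
by rewrite scaler_sumr; apply: eq_bigr => j _; rewrite !scalerA mulrC.
Qed.

Lemma ideal_pow0 M (m : M) : ideal_pow_smul I 0 m.
Proof.
exists 1%N, (fun _ _ => 0), (fun=> m); split=> [_ [] // | ].
by rewrite big_ord1 big_ord0 scale1r.
Qed.

Lemma ideal_powSM M n a (m : M) : I a -> ideal_pow_smul I n m ->
  ideal_pow_smul I n.+1 (a *: m).
Proof.
move=> ha [k [b [v [hb ->]]]].
exists k, (fun j l => if unlift ord0 l is Some l' then b j l' else a), v; split.
  by move=> j l; case: (unlift _ _).
rewrite scaler_sumr; apply: eq_bigr => j _.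
rewrite scalerA big_ord_recl unlift_none; congr (_ * _ *: _).
by apply: eq_bigr => l _; rewrite liftK.
Qed.

Lemma ideal_powS_min M n (N : M -> Prop) : submod N ->
  (forall a m, I a -> ideal_pow_smul I n m -> N (a *: m)) ->
  forall m, ideal_pow_smul I n.+1 m -> N m.
Proof.
move=> hN h _ [k [a [v [ha ->]]]]; apply: submod_sum => // j _.
rewrite big_ord_recl -scalerA; apply: h => //.
by exists 1%N, (fun _ l => a j (lift ord0 l)), (fun=> v j); split; rewrite ?big_ord1.
Qed.

Lemma ideal_pow_leq M n k (m : M) : (k <= n)%N -> ideal_pow_smul I n m ->
  ideal_pow_smul I k m.
Proof.
move=> /subnK <-; elim: (n - k)%N => // d IH h; apply: IH; move: m h.
apply: ideal_powS_min => [|a m _ hm]; first exact: ideal_pow_submod.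
by apply: submodZ => //; exact: ideal_pow_submod.
Qed.

Lemma ideal_pow_mul M n d (c : R^o) (m : M) : ideal_pow_smul I n c ->
  ideal_pow_smul I d m -> ideal_pow_smul I (n + d) (c *: m).
Proof.
move=> hc hm; elim: n c hc => [|n IHn] c hc.
  by apply: submodZ => //; exact: ideal_pow_submod.
apply: (@ideal_powS_min R^o n (fun c => ideal_pow_smul I (n.+1 + d) (c *: m))) hc.
  exact: ideal_colon (ideal_pow_submod _ _).
by move=> a b ha /IHn hb; rewrite -scalerA; exact: ideal_powSM.
Qed.

Lemma ideal_pow_coord M p (u : 'I_p -> M) :
  (forall m, exists c : 'I_p -> R, m = \sum_(j < p) c j *: u j) ->
  forall n m, ideal_pow_smul I n m -> exists c : 'I_p -> R,
    (forall j, @ideal_pow_smul R I n R^o (c j)) /\ m = \sum_(j < p) c j *: u j.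
Proof.
move=> hu; elim=> [|n IHn] m.
  by have [c ->] := hu m => _; exists c; split=> // j; exact: ideal_pow0.
move: m; have hP k := @ideal_pow_submod R^o k.
apply: ideal_powS_min => [|a m ha /IHn [c [hc ->]]]; last first.
  exists (fun j => a * c j); split=> [j|]; first exact: (@ideal_powSM R^o).
  by rewrite scaler_sumr; apply: eq_bigr => j _; rewrite scalerA.
split.
  exists (fun=> 0); split=> [j|]; first exact: (submod0 (hP _)).
  by rewrite big1 // => j _; rewrite scale0r.
split=> [_ _ [c [hc ->]] [d [hd ->]] | r _ [c [hc ->]]].
  exists (fun j => c j + d j); split=> [j|]; first exact: (submodD (hP _)).
  by rewrite -big_split; apply: eq_bigr => j _; rewrite scalerDl.
exists (fun j => r * c j); split=> [j|]; first exact: (submodZ _ (hP _)).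
by rewrite scaler_sumr; apply: eq_bigr => j _; rewrite scalerA.
Qed.

End IdealPowers.

Lemma ideal_pow_mono (R : comNzRingType) (I J : R -> Prop) (M : lmodType R) n (m : M) :
  (forall a, I a -> J a) -> ideal_pow_smul I n m -> ideal_pow_smul J n m.
Proof. by move=> IJ [k [a [v [ha ->]]]]; exists k, a, v; split=> // j l; exact: IJ. Qed.

(** This is [(J + (x))^(m + k) <= J^m + (x^k)] applied to [M]. Induction on [m + k], for all [N] at
    once: splitting one factor as [b + r * x] replaces [N] by its colon by [b], lowering [m], or by
    [x], lowering [k]. *)
Lemma ideal_pow_adjoin (R : comNzRingType) (J J' : R -> Prop) (x : R) (M : lmodType R) :
  (forall a, J' a -> exists b r, J b /\ a = b + r * x) ->
  forall m k (N : M -> Prop), submod N ->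
  (forall g, ideal_pow_smul J m g -> N g) -> (forall g, N (x ^+ k *: g)) ->
  forall g, ideal_pow_smul J' (m + k) g -> N g.
Proof.
move=> hJ' m k; move defn: (m + k)%N => n; elim: n m k defn => [|n IHn] m k defn N hN hm hk.
  move=> g _; apply: hm; have -> : m = 0%N by lia.
  exact: ideal_pow0.
case: m defn hm => [|m] defn hm; first by move=> g _; apply: hm; exact: ideal_pow0.
case: k defn hk => [|k] defn hk; first by move=> g _; rewrite -[g]scale1r -[1](expr0 x).
apply: ideal_powS_min => // a g /hJ' [b [r [hb ->]]] hg.
rewrite scalerDl -scalerA; apply: (submodD hN).
  apply: (IHn m k.+1 _ (fun g => N (b *: g)) _ _ _ g hg); [by lia | exact: submod_colon | |].
    by move=> h hh; apply: hm; exact: ideal_powSM.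
  by move=> h; exact: (submodZ _ hN).
apply: (submodZ _ hN).
apply: (IHn m.+1 k _ (fun g => N (x *: g)) _ _ _ g hg); [by lia | exact: submod_colon | |].
  by move=> h hh; apply: (submodZ _ hN); exact: hm.
by move=> h; rewrite scalerA -exprS.
Qed.

(** The leading coefficients stop growing at some degree [d]. The elements of [J] of degree at most
    [d] form a finitely generated [S]-module, and its generators already generate [J]. *)
Theorem hilbert_basis (S : comNzRingType) :
  noetherian_ring S -> noetherian_ring {poly S}.
Proof.
move=> hS J hJ; apply: fingen_ideal_fg.
have [J0 [JD JM]] := hJ.
(* The degree of [f] may be smaller than [d]; allowing the coefficient zero makes [L d] an ideal. *)
pose L d c := exists f : {poly S}, J f /\ (size f <= d.+1)%N /\ f`_d = c.
have Lle n k c : (n <= k)%N -> L n c -> L k c.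
  move=> nk [f [hf [sf <-]]]; exists ('X^(k - n) * f); split; first exact: JM.
  split; last by rewrite coefXnM ltnNge leq_subr /= subKn.
  have [-> | f0] := eqVneq f 0; first by rewrite mulr0 size_poly0.
  by rewrite mulrC size_mulXn //; lia.
have LI d : is_ideal (L d).
  split; first by exists 0; rewrite size_poly0 coef0.
  split=> [_ _ [f [hf [sf <-]]] [g [hg [sg <-]]] | r _ [f [hf [sf <-]]]].
    exists (f + g); rewrite coefD; split; first exact: JD.
    by split=> //; apply: leq_trans (size_polyD _ _) _; rewrite geq_max sf.
  exists (r%:P * f); rewrite coefCM; split; first exact: JM.
  by split=> //; rewrite mul_polyC; apply: leq_trans (size_scale_leq _ _) _.
have UI : is_ideal (fun c => exists d, L d c).
  split; first by exists 0%N; exact: (LI _).1.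
  split=> [a b [n ha] [k hb] | r a [n ha]]; last by exists n; exact: (LI _).2.2.
  exists (maxn n k); apply: (LI _).2.1; first exact: Lle (leq_maxl _ _) ha.
  exact: Lle (leq_maxr _ _) hb.
have [cs [hcs Ucs]] := noetherian_fingen hS UI.
have [d hd] := seq_bound Lle hcs.
have Ld n c : L n c -> L d c by move=> h; apply: (Ucs c _ _ (LI d) hd); exists n.
pose Jd (f : {poly S}) := J f /\ (size f <= d.+1)%N.
have hJd : submod Jd.
  split; first by rewrite /Jd size_poly0.
  split=> [f g [hf sf] [hg sg] | r f [hf sf]]; split; first exact: JD.
  - by apply: leq_trans (size_polyD _ _) _; rewrite geq_max sf.
  - by rewrite -mul_polyC; exact: JM.
  - by apply: leq_trans (size_scale_leq _ _) _.
have [t [ht Jt]] : fingen Jd.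
  apply: (@fingen_sub_span _ _ [seq 'X^i | i <- iota 0 d.+1]) => // f [_ sf] N hN hX.
  have -> : f = \poly_(i < d.+1) f`_i.
    apply/polyP=> i; rewrite coef_poly; case: ltnP => // hi.
    by rewrite nth_default // (leq_trans sf).
  rewrite poly_def; apply: submod_sum => // i _; apply: submodZ => //.
  by apply: hX; apply: (map_f (fun i : nat => 'X^i)); rewrite mem_iota add0n ltn_ord.
exists t; split=> [f /ht [] // | ].
move=> f hf N hN htN.
have hN' : submod (N : {poly S} -> Prop).
  have [N0 [ND NZ]] := hN; split=> //; split=> // r g hg.
  by rewrite -mul_polyC; exact: NZ.
have JdN g : Jd g -> N g by move=> /Jt h; exact: (h (N : {poly S} -> Prop)).
move: {2}(size f) (leqnn (size f)) => n; elim: n f hf => [|n IHn] f hf sf.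
  by apply: JdN; split=> //; exact: leq_trans sf _.
have [nd | dn] := leqP n d; first by apply: JdN; split=> //; exact: leq_trans sf _.
(* Above degree [d] the leading term of [f] is cancelled by a shift of some [h] in [J] of degree at
   most [d]. *)
have [h [hh [sh eh]]] : L d f`_n by apply: (Ld n); exists f.
have hXh : N ('X^(n - d) * h) by have [_ [_ NZ]] := hN; apply: NZ; exact: JdN.
rewrite -[f](subrK ('X^(n - d) * h)); apply: (submodD hN) => //; apply: IHn.
  by apply: JD => //; rewrite -mulNr; exact: JM.
apply/leq_sizeP=> j; rewrite leq_eqVlt => /orP [/eqP <- | hj].
  by rewrite coefB coefXnM ltnNge leq_subr /= subKn ?eh ?subrr // ltnW.
rewrite coefB coefXnM ifF; last by lia.
rewrite !nth_default ?subrr //; first by apply: leq_trans sh _; lia.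
exact: leq_trans sf _.
Qed.

(** * The Rees ring *)

Section Rees.
Variables (R : comNzRingType) (I : R -> Prop).
Hypotheses (hR : noetherian_ring R) (hI : is_ideal I).

(** [S] is an iterated polynomial ring with one variable for each element [x] of [s], sent by [rho]
    to [x *: 'X]. The Rees ring enters only as the target of [rho], so no subring has to be built
    and [hilbert_basis] applies to [S] directly. *)
Lemma rees_adjoin (s : seq R) : (forall x, x \in s -> I x) ->
  exists (S : comNzRingType) (rho : {rmorphism S -> {poly R}}),
    [/\ noetherian_ring S, forall c, exists a, rho a = c%:P,
        forall x, x \in s -> exists a, rho a = x *: 'X
      & forall a n, @ideal_pow_smul R I n R^o (rho a)`_n].
Proof.
have hP n := ideal_pow_submod I R^o n.
elim: s => [|x s IHs] hs.
  exists R, polyC; split=> // [c | a n]; first by exists c.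
  by rewrite coefC; case: n => [|n]; [exact: ideal_pow0 | exact: submod0 (hP _)].
have [S [rho [hS hC hX hrho]]] := IHs (fun y hy => hs y (@mem_behead _ (x :: s) y hy)).
have hcomm : commr_rmorph rho (x *: 'X) by move=> a; rewrite /GRing.comm mulrC.
exists {poly S}, (horner_morph hcomm); split.
- exact: hilbert_basis.
- by move=> c; have [a <-] := hC c; exists a%:P; rewrite /= horner_morphC.
- move=> y; rewrite inE => /orP [/eqP -> | /hX [a <-]].
    by exists 'X; rewrite /= horner_morphX.
  by exists a%:P; rewrite /= horner_morphC.
elim/poly_ind => [|p c IHp] n; first by rewrite rmorph0 coef0; exact: submod0 (hP _).
rewrite rmorphD rmorphM /= horner_morphX horner_morphC coefD.
apply: (submodD (hP n)) => //; rewrite -scalerAr coefZ coefMX.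
case: n => [|n] /=; first by rewrite mulr0; exact: submod0 (hP _).
by apply: (@ideal_powSM R I R^o) => //; apply: hs; exact: mem_head.
Qed.

(** The last two clauses say that the image of [rho] is exactly the Rees ring, the polynomials whose
    coefficient of ['X^n] lies in [I^n]. *)
Lemma rees_ring : exists (S : comNzRingType) (rho : {rmorphism S -> {poly R}}),
    [/\ noetherian_ring S,
        forall n (c : R^o), ideal_pow_smul I n c -> exists a, rho a = (c : R) *: 'X^n
      & forall a n, @ideal_pow_smul R I n R^o (rho a)`_n].
Proof.
have [s [hs Is]] := noetherian_fingen hR hI.
have [S [rho [hS hC hX hrho]]] := rees_adjoin hs.
exists S, rho; split=> //.
have hsub n : submod (fun c : R^o => exists a, rho a = (c : R) *: 'X^n).
  split; first by exists 0; rewrite rmorph0 scale0r.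
  split=> [c d [a ha] [b hb] | r c [a ha]].
    by exists (a + b); rewrite rmorphD ha hb -scalerDl.
  by have [b hb] := hC r; exists (b * a); rewrite rmorphM ha hb mul_polyC scalerA.
elim=> [|n IHn] c.
  by have [a ha] := hC c => _; exists a; rewrite ha expr0 alg_polyC.
move: c; apply: ideal_powS_min => // a m ha /IHn [b hb].
have [d hd] : exists d, rho d = (a : R) *: 'X^1 by exact: (Is a ha _ (hsub 1%N)).
by exists (d * b); rewrite rmorphM hb hd expr1 -scalerAl -scalerAr scalerA -exprS.
Qed.

(** One of the [q.+1] factors from [I] is spent on moving [w] into [I^d M + Z]; the other [q] raise
    the power. *)
Lemma ideal_pow_shift (M : lmodType R) (Z : M -> Prop) (w : M) q d (a : R^o) :
  submod Z -> (forall b, I b -> subadd (ideal_pow_smul I d (M := M)) Z (b *: w)) ->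
  ideal_pow_smul I q.+1 a -> subadd (ideal_pow_smul I (q + d) (M := M)) Z (a *: w).
Proof.
move=> hZ hw; move: a.
apply: (@ideal_powS_min R I R^o q
  (fun a => subadd (ideal_pow_smul I (q + d) (M := M)) Z (a *: w))).
  exact: ideal_colon (submod_add (ideal_pow_submod _ _ _) hZ).
move=> b c hb hc; rewrite [b *: c]mulrC -scalerA.
have [y [z [hy [hz ->]]]] := hw _ hb.
exists (c *: y), (c *: z); rewrite scalerDr; split; first exact: ideal_pow_mul.
by split=> //; exact: submodZ.
Qed.

(** For generators [x i] of [I], the families [(x i *: v)] modulo [Z] that have representatives in
    [I^d M] form, over all [d], a module over the Rees ring. It is generated in degrees at most some
    [k]; beyond [k], a suitable [v] can therefore be found in [I^(d-1) M + Z], and it differs from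
    the given [w] by an element of [(Z : I)]. *)
Lemma ideal_pow_colon (M : lmodType R) (Z : M -> Prop) : noeth_module M -> submod Z ->
  exists k, forall n, (k <= n)%N -> forall w,
    (forall a, I a -> subadd (ideal_pow_smul I n.+1 (M := M)) Z (a *: w)) ->
    subadd (ideal_pow_smul I n (M := M)) (fun m => forall a, I a -> Z (a *: m)) w.
Proof.
move=> hM hZ; have [p [u hu]] := noeth_module_gens hM.
have [r [x [hx Ix]]] := hR hI.
have [S [rho [hS hsurj hrho]]] := rees_ring.
have hP n := ideal_pow_submod I M n.
have hZ' : submod (fun m => forall a, I a -> Z (a *: m)).
  by apply: submod_bigcap => a _; exact: submod_colon.
have genI (N : M -> Prop) w : submod N -> (forall i, N (x i *: w)) ->
    forall a, I a -> N (a *: w).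
  move=> hN hxw a /Ix [c ->]; rewrite scaler_suml; apply: (submod_sum _ hN) => i _.
  by rewrite -scalerA; exact: submodZ.
pose e (f : 'M[S]_(r, p)) i d : M := \sum_(j < p) (rho (f i j))`_d *: u j.
have eP f i d : ideal_pow_smul I d (e f i d).
  apply: (submod_sum _ (hP d)) => j _; rewrite -[d]addn0.
  by apply: (@ideal_pow_mul R I M d 0) => //; [rewrite addn0 | exact: ideal_pow0].
have eD f g i d : e (f + g) i d = e f i d + e g i d.
  by rewrite -big_split; apply: eq_bigr => j _; rewrite mxE rmorphD coefD scalerDl.
have eZ a f i d : e (a *: f) i d = \sum_(l < d.+1) (rho a)`_(d - l) *: e f i l.
  transitivity (\sum_(j < p) \sum_(l < d.+1) (rho a)`_(d - l) *: ((rho (f i j))`_l *: u j)).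
    apply: eq_bigr => j _; rewrite mxE rmorphM coefMr scaler_suml.
    by apply: eq_bigr => l _; rewrite scalerA.
  by rewrite exchange_big; apply: eq_bigr => l _; rewrite scaler_sumr.
have e0 i d : e 0 i d = 0 by apply: big1 => j _; rewrite mxE rmorph0 coef0 scale0r.
(* [x i *: v] for one [v] and all [i]: the image of [M] in [(M / Z)^r], whose intersection
   with the [I]-adic filtration is a module over the Rees ring. *)
pose E (b : bool) k f := forall d, exists v,
  (b -> (k < d)%N -> subadd (ideal_pow_smul I d.-1 (M := M)) Z v) /\
  forall i, Z (x i *: v - e f i d).
have hE b k : submod (E b k).
  split.
    move=> d; exists 0; split=> [_ _ | i].
      by apply: submod0; apply: submod_add.
    by rewrite scaler0 e0 subrr; exact: submod0.
  split=> [f g hf hg d | a f hf d].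
    have [v [hv hvZ]] := hf d; have [w [hw hwZ]] := hg d.
    exists (v + w); split=> [bT kd | i].
      by apply: submodD; [exact: submod_add | exact: hv | exact: hw].
    by rewrite eD scalerDr opprD addrACA; exact: submodD.
  have /choice [v hv] := hf.
  exists (\sum_(l < d.+1) (rho a)`_(d - l) *: v l); split=> [bT kd | i]; last first.
    rewrite eZ scaler_sumr -sumrB; apply: (submod_sum _ hZ) => l _.
    rewrite scalerA mulrC -scalerA -scalerBr; apply: submodZ => //.
    exact: (hv l).2.
  have hA := submod_add (hP d.-1) hZ.
  apply: (submod_sum _ hA) => l _.
  (* For [l > k] the membership of [v l] is known and the coefficient in [I^(d - l)] raises its
     power. For [l <= k < d] only [I * v l <= I^l M + Z] is known, so one factor of the coefficient
     is spent on [v l]; this is why the exponent is [d.-1]. *)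
  have [kl | lk] := ltnP k l.
    have [y [z [hy [hz ->]]]] := (hv l).1 bT kl.
    rewrite scalerDr; apply: (submodD hA); last first.
      by apply: subaddr => //; exact: submodZ.
    apply: subaddl => //; have -> : (d.-1 = (d - l) + l.-1)%N by have := ltn_ord l; lia.
    exact: ideal_pow_mul.
  have -> : (d.-1 = (d - l).-1 + l)%N by lia.
  apply: ideal_pow_shift => //; last by rewrite prednK //; lia.
  apply: genI => [|i]; first exact: submod_add.
  exists (e f i l), (x i *: v l - e f i l); split=> //; split; last by rewrite addrC subrK.
  exact: (hv l).2.
have [t [ht E0t]] := noeth_matrix hS (hE false 0%N).
have [k hk] : exists k, forall f, f \in t -> forall i j, (size (rho (f i j)) <= k.+1)%N.
  apply: (@seq_bound _ t (fun k f => forall i j, (size (rho (f i j)) <= k.+1)%N)).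
    by move=> n k f nk hf i j; apply: leq_trans (hf i j) _.
  move=> f _; exists (\max_i \max_j size (rho (f i j))) => i j; apply: leqW.
  apply: leq_trans (leq_bigmax i) => /=.
  exact: (leq_bigmax (F := fun j => size (rho (f i j))) j).
have E0E f : E false 0%N f -> E true k f.
  move=> /E0t; apply; first exact: hE.
  move=> g gt d; have [v [_ hv]] := ht g gt d.
  have [kd | dk] := ltnP k d; last by exists v; split=> // _; rewrite ltnNge dk.
  (* Above degree [k] the generator [g] vanishes, so zero can replace the original [v]. *)
  exists 0; split=> [_ _ | i]; first by apply: submod0; exact: submod_add.
  rewrite scaler0 sub0r; apply: submodN => //.
  rewrite /e big1 => [|j _]; first exact: submod0.
  by rewrite nth_default ?scale0r // (leq_trans (hk g gt i j)).
exists k => n kn w hw.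
have /choice [y hy] : forall i, exists y, ideal_pow_smul I n.+1 y /\ Z (x i *: w - y).
  move=> i; have [y [z [hy [hz ->]]]] := hw _ (hx i).
  by exists y; split=> //; rewrite addrC addKr.
have /choice [s hs] : forall i, exists s : 'I_p -> S, forall d,
    \sum_(j < p) (rho (s j))`_d *: u j = if d == n.+1 then y i else 0.
  move=> i; have [c [hc ->]] := ideal_pow_coord hu (hy i).1.
  have /choice [s hs] : forall j, exists s, rho s = (c j : R) *: ('X^(n.+1) : {poly R}).
    by move=> j; exact: hsurj.
  exists s => d; case: eqP => [-> | /eqP/negPf dn].
    by apply: eq_bigr => j _; rewrite hs coefZ coefXn eqxx mulr1.
  by apply: big1 => j _; rewrite hs coefZ coefXn dn mulr0 scale0r.
(* [f] is concentrated in degree [n.+1], where [w] shows that it lies in [E false 0]; the passage to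
   [E true k] yields a better [v] there. *)
pose f := \matrix_(i, j) s i j.
have ef i d : e f i d = if d == n.+1 then y i else 0.
  by rewrite -hs; apply: eq_bigr => j _; rewrite mxE.
have /E0E /(_ n.+1) [v [hv hvZ]] : E false 0%N f.
  move=> d; exists (if d == n.+1 then w else 0); split=> // i; rewrite ef.
  case: eqP => _; first exact: (hy i).2.
  by rewrite scaler0 subrr; exact: submod0.
have [b [z [hb [hz defv]]]] := hv isT kn.
exists b, (z + (w - v)); split=> //; split; last first.
  by rewrite addrA -defv addrC subrK.
apply: (submodD hZ'); first by move=> a _; exact: submodZ.
apply: genI => // i.
have -> : x i *: (w - v) = (x i *: w - y i) - (x i *: v - e f i n.+1).
  by rewrite ef eqxx scalerBr opprB addrA subrK.
by apply: submodB => //; exact: (hy i).2.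
Qed.

End Rees.

(** * Primes in a one-dimensional domain *)

Lemma prime_expr (R : comNzRingType) (P : R -> Prop) x n :
  prime_ideal P -> P (x ^+ n) -> P x.
Proof.
move=> [_ [P1 PM]]; elim: n => [|n IHn]; first by rewrite expr0 => /P1.
by rewrite exprS => /PM [|/IHn].
Qed.

(** Among the multiples of [t0] outside [N], one whose annihilator modulo [N] is maximal has a prime
    annihilator. *)
Lemma noeth_colon_prime (R : comNzRingType) (M : lmodType R) (N : M -> Prop) (t0 : M) :
  noetherian_ring R -> submod N -> ~ N t0 ->
  exists c, ~ N (c *: t0) /\ prime_ideal (fun r => N (r *: (c *: t0))).
Proof.
move=> hR hN ht0.
pose Q (J : R^o -> Prop) := exists c, ~ N (c *: t0) /\ J = (fun r => N (r *: (c *: t0))).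
have [J [[c [hc defJ]] Jmax]] : exists J, Q J /\ forall J', Q J' ->
    (forall m, J m -> J' m) -> forall m, J' m -> J m.
  apply: (@noeth_max R R^o Q (fun r => N (r *: (1 *: t0)))).
  - exact: noetherian_regular.
  - by move=> _ [c [_ ->]]; exact: ideal_colon.
  - by exists 1; rewrite scale1r.
exists c; split=> //; split; first exact: ideal_colon.
split=> [|a b hab]; first by rewrite scale1r.
have [hb | hb] := EM (N (b *: (c *: t0))); [by right | left].
pose J' r := N (r *: ((b * c) *: t0)).
have : J' a by rewrite /J' -scalerA scalerA.
have QJ' : Q J' by exists (b * c); split=> //; rewrite -scalerA.
move/(Jmax _ QJ'); rewrite defJ; apply=> r hr.
by rewrite /J' -scalerA scalerA mulrC -scalerA; exact: submodZ.
Qed.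

Section DimensionOne.
Variable R : idomainType.
Hypotheses (hR : noetherian_ring R) (hdim : krull_dim_one R).

Lemma prime_zero : prime_ideal (fun x : R => x = 0).
Proof.
split; first by split=> //; split=> [x y -> -> | r x ->]; rewrite ?addr0 ?mulr0.
split=> [/eqP | a b /eqP]; first by rewrite oner_eq0.
by rewrite mulf_eq0 => /orP [] /eqP; [left | right].
Qed.

(** Otherwise zero, [P] and [Q] would form a chain of three primes. *)
Lemma prime_sub_eq (P Q : R -> Prop) (x : R) : prime_ideal P -> prime_ideal Q ->
  P x -> x <> 0 -> (forall y, P y -> Q y) -> forall y, Q y -> P y.
Proof.
move=> hP hQ Px x0 PQ y Qy; apply: contrapT => Py; apply: hdim.2.
exists (fun x => x = 0), P, Q; split; first exact: prime_zero.
split=> //; split=> //; split; last by split=> //; exists y.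
by split=> [_ -> | ]; [exact: hP.1.1 | exists x].
Qed.

(** If [r] were not invertible modulo [P], then [P + (r)] would be proper. The annihilator of a
    suitable multiple of 1 modulo it is a prime strictly above [P], against dimension one. *)
Lemma prime_maximal (P : R -> Prop) (x : R) : prime_ideal P -> P x -> x <> 0 ->
  forall r, ~ P r -> exists s, P (1 - s * r).
Proof.
move=> hP Px x0 r Pr; apply: contrapT => hr.
pose J := subadd (P : R^o -> Prop) (fun m : R^o => exists s : R, m = s *: (r : R^o)).
have hPs : submod (P : R^o -> Prop) := hP.1.
have hJ : submod J := submod_add hPs (submod_line _).
have J1 : ~ J 1.
  by move=> [a [_ [ha [[s ->] e]]]]; apply: hr; exists s; rewrite e addrK.
have [c [hc hQ]] := noeth_colon_prime hR hJ J1.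
have JQ y : J y -> J (y *: (c *: (1 : R^o))).
  move=> hy; rewrite [c *: _]mulr1 [y *: _]mulrC; exact: (submodZ _ hJ).
apply: (Pr); apply: (prime_sub_eq hP hQ Px x0) => [y Py|]; apply: JQ.
  exact: subaddl (submod_line _) Py.
by apply: subaddr => //; exists 1; rewrite scale1r.
Qed.

(** Noetherian induction takes the place of counting the primes over [I]. An ideal [J] containing
    [I] and maximal among those for which the primes over [J] do not stabilise can be neither prime
    nor non-prime. *)
Lemma monotone_primes_stable (I : R -> Prop) (a0 : R) (A : nat -> (R -> Prop) -> Prop) n0 :
  is_ideal I -> I a0 -> a0 <> 0 ->
  (forall n P, A n P -> prime_ideal P /\ forall a, I a -> P a) ->
  (forall n P, (n0 <= n)%N -> A n P -> A n.+1 P) ->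
  exists n1, (n0 <= n1)%N /\ forall n, (n1 <= n)%N -> forall P, A n P <-> A n1 P.
Proof.
move=> hI Ia0 a00 hA Amon.
have Ale n m P : (n0 <= n)%N -> (n <= m)%N -> A n P -> A m P.
  move=> n0n /subnK <-; elim: (m - n)%N => // d IH /IH; apply: Amon; lia.
pose st (J : R -> Prop) n1 := (n0 <= n1)%N /\ forall n, (n1 <= n)%N ->
  forall P, (forall a, J a -> P a) -> A n P -> A n1 P.
have stle J n m : (n <= m)%N -> st J n -> st J m.
  move=> nm [n0n h]; split=> [|k mk P JP hk]; first exact: leq_trans nm.
  by apply: (Ale n) => //; apply: h hk => //; exact: leq_trans mk.
suff [n1 [n01 h]] : exists n1, st I n1.
  exists n1; split=> // n n1n P; split; last exact: Ale.
  by move=> hn; apply: h (hn) => //; exact: (hA _ _ hn).2.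
apply: contrapT => hno.
pose Q (J : R^o -> Prop) := submod J /\ (forall a, I a -> J a) /\ ~ exists n1, st J n1.
have [J [[hJ [IJ Jno]] Jmax]] : exists J, Q J /\ forall J', Q J' ->
    (forall m, J m -> J' m) -> forall m, J' m -> J m.
  by apply: (@noeth_max R R^o Q I) => [|N []//|]; first exact: noetherian_regular.
pose adj x := subadd J (fun m : R^o => exists s : R, m = s *: (x : R^o)).
have adj_sub x y : J y -> adj x y by apply: subaddl; exact: submod_line.
have stadj x : ~ J x -> exists n1, st (adj x) n1.
  move=> Jx; apply: contrapT => hx; apply: Jx; apply: (Jmax (adj x)).
  - split; first exact: submod_add (submod_line _).
    by split=> // a /IJ; exact: adj_sub.
  - exact: adj_sub.
  - by apply: subaddr => //; exists 1; rewrite scale1r.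
have adjP x (P : R -> Prop) : prime_ideal P -> (forall a, J a -> P a) -> P x ->
    forall a, adj x a -> P a.
  move=> hP JP Px a; apply: (@subadd_min R R^o J _ P) => //; first exact: hP.1.
  by move=> _ [s ->]; exact: hP.1.2.2.
have [hJp | ] := EM (prime_ideal J).
  (* Since [J] is a nonzero prime, it is the only prime over [J] that can occur: it occurs from some
     index on, or never from [n0] on. *)
  apply: Jno; have [hex | hnex] := EM (exists n, (n0 <= n)%N /\ A n J); last first.
    exists n0; split=> // n n0n P JP hn.
    have := hA _ _ hn.
    have /funext eP : P =1 J.
      move=> x; apply: propext; split; last exact: JP.
      by apply: (prime_sub_eq hJp (hA _ _ hn).1 (IJ _ Ia0)).
    by case: hnex; exists n; rewrite -eP.
  have [n [n0n hn]] := hex; exists n; split=> // m nm P JP hm.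
  suff -> : P = J by [].
  apply/funext => x; apply: propext; split; last exact: JP.
  by apply: (prime_sub_eq hJp (hA _ _ hm).1 (IJ _ Ia0)).
move=> hJp; apply: Jno.
have [J1 | J1] := EM (J 1).
  exists n0; split=> // n _ P JP /hA [[_ [P1 _]] _].
  by case: P1; exact: JP.
have [a [b [hab [ha hb]]]] : exists a b, J (a * b) /\ ~ J a /\ ~ J b.
  apply: contrapT => h; apply: hJp; split=> //; split=> // a b hab.
  have [? | ha] := EM (J a); first by left.
  have [? | hb] := EM (J b); first by right.
  by case: h; exists a, b.
(* A prime over [J] contains [a * b], hence lies over [J + (a)] or [J + (b)], and both of these
   stabilise by maximality. *)
have [m hm] := stadj _ ha; have [k hk] := stadj _ hb.
have [n0n hn1] := stle _ _ _ (leq_maxl m k) hm.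
have [_ hn2] := stle _ _ _ (leq_maxr m k) hk.
exists (maxn m k); split=> // n hn P JP hAn.
have hP := (hA _ _ hAn).1.
have [Pa | Pb] := hP.2.2 _ _ (JP _ hab).
  by apply: hn1 hAn => //; exact: adjP.
by apply: hn2 hAn => //; exact: adjP.
Qed.

End DimensionOne.

(** * Associated primes of a filtration *)

Section Torsion.
Variables (R : comNzRingType) (I : R -> Prop) (G : lmodType R) (K : G -> Prop).
Hypotheses (hI : is_ideal I) (hG : noeth_module G) (hK : submod K).

(** The exponent may depend on [x]; for a finitely generated [I] this still describes the elements
    that some power of [I] carries into [K]. *)
Definition torsion_mod (m : G) : Prop := forall x, I x -> exists s, K (x ^+ s *: m).

Lemma torsion_mod_submod : submod torsion_mod.
Proof.
apply: submod_bigcap => x _.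
have leK n k m : (n <= k)%N -> K (x ^+ n *: m) -> K (x ^+ k *: m).
  by move=> /subnK <-; rewrite exprD -scalerA; apply: submodZ.
split; first by exists 0%N; rewrite scaler0; exact: submod0.
split=> [y z [n hy] [k hz] | r y [n hy]]; last first.
  by exists n; rewrite scalerA mulrC -scalerA; exact: submodZ.
exists (maxn n k); rewrite scalerDr; apply: submodD => //.
  by apply: leK hy; exact: leq_maxl.
by apply: leK hz; exact: leq_maxr.
Qed.

Lemma torsion_mod_sub m : K m -> torsion_mod m.
Proof. by move=> hm x _; exists 0%N; rewrite expr0 scale1r. Qed.

(* An instance of the Artin-Rees lemma, obtained without it from a submodule [N] that is maximal
   subject to meeting the torsion only in [K]: each [x] in [I] is nilpotent on [G / N]. *)
Lemma ideal_pow_torsion : noetherian_ring R ->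
  exists k, forall m, ideal_pow_smul I k m -> torsion_mod m -> K m.
Proof.
move=> hR; have hT := torsion_mod_submod.
pose Q (N : G -> Prop) := [/\ submod N, forall m, K m -> N m
  & forall m, N m -> torsion_mod m -> K m].
have [N [[hN KN NT] Nmax]] : exists N, Q N /\ forall N', Q N' ->
    (forall m, N m -> N' m) -> forall m, N' m -> N m.
  by apply: (@noeth_max R G Q K) => [//|N []//|]; split.
have nilp x : I x -> exists k, forall g, N (x ^+ k *: g).
  move=> hx; pose D k (m : G) := N (x ^+ k *: m).
  have hD k : submod (D k) by exact: submod_colon.
  (* The chain of colons [(N : x^k)] stabilises. For such a [k], the sum [N + x^k G] still meets the
     torsion only in [K], so by maximality it equals [N]. *)
  have [_ [[k ->] kmax]] : exists C, (exists k, C = D k) /\ forall C', (exists k, C' = D k) ->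
      (forall m, C m -> C' m) -> forall m, C' m -> C m.
    by apply: (@noeth_max R G _ (D 0%N)) => [//|_ [k ->]//|]; exists 0%N.
  have Dk s m : D (s + k)%N m -> D k m.
    apply: kmax; first by exists (s + k)%N.
    by move=> y hy; rewrite /D exprD -scalerA; exact: submodZ.
  have hB : submod (fun m : G => exists g, m = x ^+ k *: g).
    split; first by exists 0; rewrite scaler0.
    split=> [_ _ [g ->] [h ->] | r _ [g ->]]; first by exists (g + h); rewrite scalerDr.
    by exists (r *: g); rewrite !scalerA mulrC.
  exists k => g; apply: (Nmax (subadd N (fun m => exists g, m = x ^+ k *: g))).
  - split; first exact: submod_add.
      by move=> m /KN; exact: subaddl.
    move=> _ [b [_ [hb [[h ->] ->]]]] hbh.
    have [s hs] := hbh _ hx; apply: NT => //; apply: submodD => //; apply: (Dk s).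
    rewrite /D exprD -scalerA -[_ *: (_ *: h)](addKr (x ^+ s *: b)) -scalerDr.
    by apply: submodD => //; [apply: submodN => //; exact: submodZ | exact: KN].
  - by move=> m; exact: subaddl.
  by apply: subaddr => //; exists g.
have [s [hs Is]] := noetherian_fingen hR hI.
(* Generators of [I] are adjoined one at a time; for the empty list the ideal is zero and the
   exponent 1 suffices. *)
have [k hk] : exists k, forall g, ideal_pow_smul (spanned (fun x : R^o => x \in s)) k g -> N g.
  elim: s hs {Is} => [|x s IHs] hs.
    exists 1%N; apply: ideal_powS_min => // a m ha _.
    suff -> : a = 0 by rewrite scale0r; exact: submod0.
    apply: (ha (fun x => x = 0)) => //; split=> //.
    by split=> [y z -> -> | r y ->]; rewrite ?addr0 ?scaler0.
  have [n hn] := IHs (fun y hy => hs y (@mem_behead _ (x :: s) y hy)).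
  have [k hk] := nilp x (hs _ (mem_head _ _)).
  exists (n + k)%N; apply: ideal_pow_adjoin hn hk => // a ha.
  have [c [y [hy ->]]] := spanned_cons ha.
  by exists y, c; split=> //; rewrite addrC.
exists k => m hm; apply: NT; apply: hk.
by apply: ideal_pow_mono hm => a /Is.
Qed.

End Torsion.

Section Filtration.
Variables (R : idomainType) (I : R -> Prop) (a0 : R) (G : lmodType R).
Variables (K : G -> Prop) (W : nat -> G -> Prop).
Hypotheses (hR : noetherian_ring R) (hdim : krull_dim_one R).
Hypotheses (hI : is_ideal I) (Ia0 : I a0) (a00 : a0 <> 0).
Hypotheses (hG : noeth_module G) (hK : submod K) (hW : forall n, submod (W n)).
Hypothesis W_dec : forall n m, W n.+1 m -> W n m.
Hypothesis W_sub : forall n m, subadd K (ideal_pow_smul I n (M := G)) m -> W n m.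
Hypothesis W_mul : forall n a m, I a -> W n m -> W n.+1 (a *: m).

Let T := torsion_mod I K.
Let IG n := ideal_pow_smul I n (M := G).
Let hT : submod T. Proof. exact: torsion_mod_submod. Qed.
Let hIG n : submod (IG n). Proof. exact: ideal_pow_submod. Qed.

Definition filtration_ass n (P : R -> Prop) : Prop :=
  prime_ideal P /\ exists u, W n u /\ forall r, P r <-> subadd K (IG n) (r *: u).

Lemma K_W n m : K m -> W n m.
Proof. by move=> hm; apply: W_sub; exact: subaddl (hIG n) hm. Qed.

Lemma W_leq n k m : (n <= k)%N -> W k m -> W n m.
Proof. by move=> /subnK <-; elim: (k - n)%N => // d IH /W_dec. Qed.

(** In place of a length argument, take [N] maximal among the submodules containing [K] on which [W]
    becomes constant. A torsion element outside [N] would give a simple extension of [N], on which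
    [W] also becomes constant. *)
Lemma W_torsion_stable :
  exists k, forall n, (k <= n)%N -> forall m, T m -> W k m -> W n m.
Proof.
pose Q (N : G -> Prop) := [/\ submod N, forall m, K m -> N m
  & exists k, forall n, (k <= n)%N -> forall m, N m -> W k m -> W n m].
have [N [[hN KN [k hk]] Nmax]] : exists N, Q N /\ forall N', Q N' ->
    (forall m, N m -> N' m) -> forall m, N' m -> N m.
  apply: (@noeth_max R G Q K) => [//|N []//|]; split=> //.
  by exists 0%N => n _ m hm _; exact: K_W.
exists k => n kn m hm; apply: (hk) => //; apply: contrapT => Nm.
have [c [hc hP]] := noeth_colon_prime hR hN Nm.
set t := c *: m in hc hP; set P := (fun r => _) in hP.
have Pa0 : P a0.
  have [s hs] := hm _ Ia0; apply: (prime_expr (n := s) hP).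
  by rewrite /P /t scalerA mulrC -scalerA; apply: submodZ => //; exact: KN.
apply: hc; pose N' := subadd N (fun m : G => exists s, m = s *: t).
have hN' : submod N' by apply: submod_add => //; exact: submod_line.
have NN' y : N y -> N' y by exact: subaddl (submod_line _).
apply: (Nmax N'); [ | exact: NN' | by apply: subaddr => //; exists 1; rewrite scale1r].
split=> // [y /KN/NN' //|].
(* Either some [W n2] meets [N'] only inside [N], or every [W l] contains a [y] that generates [N']
   modulo [N]. In the second case subtracting a multiple of [y] moves any [x] of [N'] into [N]. *)
have [[n2 hn2] | hno] := EM (exists n2, forall y, N' y -> W n2 y -> N y).
  exists (maxn k n2) => l hl y N'y Wy; apply: hk; first by lia.
    by apply: hn2 => //; apply: W_leq Wy; exact: leq_maxr.
  by apply: W_leq Wy; exact: leq_maxl.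
exists k => l kl x N'x Wx.
have [y [N'y [Wy Ny]]] : exists y, N' y /\ W l y /\ ~ N y.
  apply: contrapT => h; apply: hno; exists l => y N'y Wy; apply: contrapT => Ny.
  by apply: h; exists y.
have [b [_ [hb [[r ->] defx]]]] := N'x.
have [b' [_ [hb' [[r' ->] defy]]]] := N'y.
have Pr' : ~ P r' by move=> h; apply: Ny; rewrite defy; exact: submodD.
have [s hs] := prime_maximal hR hdim hP Pa0 a00 Pr'.
rewrite -[x](subrK ((r * s) *: y)); apply: submodD => //; last exact: submodZ.
apply: hk => //; last first.
  by apply: submodB => //; apply: submodZ => //; exact: W_leq Wy.
have -> : x - (r * s) *: y = b - (r * s) *: b' + (r * (1 - s * r')) *: t.
  rewrite defx defy mulrBr mulr1 mulrA scalerBl scalerDr opprD !scalerA.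
  by rewrite addrACA.
apply: submodD => //; first by apply: submodB => //; exact: submodZ.
by rewrite -scalerA; exact: submodZ.
Qed.

(** The power [a ^+ n] carries [u] into [I^n G], hence lies in [P]. *)
Lemma filtration_ass_ideal n P : filtration_ass n P -> forall a, I a -> P a.
Proof.
move=> [hP [u [_ hu]]] a ha; apply: (prime_expr (n := n) hP); apply/hu.
apply: subaddr => //; elim: n {hu} => [|n IHn]; first exact: ideal_pow0.
by rewrite exprS -scalerA; exact: ideal_powSM.
Qed.

Lemma filtration_ass_mono :
  exists n0, forall n P, (n0 <= n)%N -> filtration_ass n P -> filtration_ass n.+1 P.
Proof.
have [n1 hn1] := W_torsion_stable.
have [n2 hn2] := ideal_pow_torsion hI hG hK hR.
pose Z m := T m /\ W n1 m.
have hZ : submod Z by exact: submod_cap.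
have KZ m : K m -> Z m.
  by move=> hm; split; [exact: torsion_mod_sub | exact: K_W].
have [n3 hn3] := ideal_pow_colon hR hI hG hZ.
exists (maxn n1 (maxn n2 n3)) => n P hn hAss.
have IP := filtration_ass_ideal hAss.
have hIT l m : (n <= l)%N -> IG l m -> T m -> K m.
  by move=> nl hm; apply: hn2; apply: ideal_pow_leq hm; lia.
have ZW l m : (n <= l)%N -> Z m -> W l m by move=> nl [Tm Wm]; apply: hn1 => //; lia.
case: hAss => hP [u [Wu hu]]; split=> //.
have KIG l : submod (subadd K (IG l)) := submod_add hK (hIG l).
have [[r [Pr [y [z [hy [hz defz]]]]]] | hno] :=
    EM (exists r, ~ P r /\ subadd (IG n) Z (r *: u)).
  (* [z] is torsion and [I^l G] meets the torsion only in [K], so the annihilator of [z] is the same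
     in all quotients from [n] on. It equals [P] because [r] is outside [P]. *)
  have annz l s : (n <= l)%N -> subadd K (IG l) (s *: z) <-> K (s *: z).
    move=> nl; split=> [[k [w [hk [hw defw]]]] | ]; last exact: subaddl (hIG l).
    rewrite defw; apply: submodD => //; apply: (hIT l) => //.
    rewrite -[w](addKr k) -defw; apply: (submodD hT).
      by apply: (submodN hT); exact: torsion_mod_sub.
    by apply: (submodZ _ hT); exact: hz.1.
  exists z; split; first exact: ZW.
  move=> s; rewrite annz // -(annz n) //.
  have -> : P s <-> P (s * r).
    split=> [hs | /hP.2.2 [] //]; by rewrite mulrC; exact: hP.1.2.2.
  rewrite hu -scalerA defz scalerDr; split=> h.
    rewrite -[s *: z](addKr (s *: y)); apply: (submodD (KIG n)) => //.
    apply: (submodN (KIG n)).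
    by apply: subaddr => //; exact: (submodZ _ (hIG n)).
  by apply: (submodD (KIG n)) => //; apply: subaddr => //; exact: (submodZ _ (hIG n)).
(* Otherwise [ideal_pow_colon] puts [u] in [I^n G + (Z : I)]. The second summand of [u] is again
   torsion and in [W n1], thus in [Z], and [r = 1] would fall under the first case. *)
have [a [ha hau]] : exists a, I a /\ ~ subadd (IG n.+1) Z (a *: u).
  apply: contrapT => h; apply: hno; exists 1; split; first exact: hP.2.1.
  have n3n : (n3 <= n)%N by lia.
  have [|y [t [hy [ht defu]]]] := hn3 n n3n u.
    by move=> a ha; apply: contrapT => hau; apply: h; exists a.
  exists y, t; rewrite scale1r; split=> //; split=> //; split.
    move=> x hx; have [s hs] := (ht _ hx).1 _ hx.
    by exists s.+1; rewrite exprSr -scalerA.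
  have -> : t = u - y by rewrite defu addrC addKr.
  apply: (@W_leq n1 n); first by lia.
  by apply: (submodB (hW n)) => //; apply: W_sub; exact: subaddr.
exists (a *: u); split; first exact: W_mul.
have P_ann r : P r -> subadd K (IG n.+1) (r *: (a *: u)).
  move=> /hu [k [y [hk [hy defr]]]]; exists (a *: k), (a *: y); split; first exact: submodZ.
  by split; [exact: ideal_powSM | rewrite -scalerDr -defr !scalerA mulrC].
move=> r; split; first exact: P_ann.
move=> hr; apply: contrapT => Pr.
(* An [r] outside [P] is invertible modulo [P]; if it killed [a *: u], the whole class of [a *: u]
   would vanish. *)
have [s hs] := prime_maximal hR hdim hP (IP _ Ia0) a00 Pr.
apply: hau; apply: (@subadd_min R G K (IG n.+1)); first exact: submod_add.
- by move=> m /KZ; exact: subaddr.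
- by move=> m; exact: subaddl.
rewrite -[a *: u]scale1r -[1](subrK (s * r)) scalerDl; apply: (submodD (KIG _)).
  exact: P_ann.
by rewrite -scalerA; exact: (submodZ _ (KIG _)).
Qed.

Theorem filtration_ass_stable : exists n0, (1 <= n0)%N /\ forall n, (n0 <= n)%N ->
  forall P, filtration_ass n P <-> filtration_ass n0 P.
Proof.
have [n0 hn0] := filtration_ass_mono.
have [n1 [n01 hn1]] := @monotone_primes_stable R hR hdim I a0 filtration_ass n0.+1 hI Ia0 a00
  (fun n P hP => conj hP.1 (filtration_ass_ideal hP)) (fun n P hn => hn0 n P (ltnW hn)).
by exists n1; split=> //; lia.
Qed.

End Filtration.

(** * Matrices presenting a tensor product *)

Section Bilinear.
Variables (R : comNzRingType) (B M W : lmodType R) (N : M -> Prop) (phi : B -> M -> W).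
Hypothesis hphi : bilin_van N phi.

Lemma bilinZl r x y : phi (r *: x) y = r *: phi x y.
Proof. by case: hphi => _ [_ [h _]]. Qed.

Lemma bilinZr r x y : phi x (r *: y) = r *: phi x y.
Proof. by case: hphi => _ [_ [_ [h _]]]. Qed.

Lemma bilin0l y : phi 0 y = 0.
Proof. by rewrite -(scale0r 0) bilinZl scale0r. Qed.

Lemma bilin0r x : phi x 0 = 0.
Proof. by rewrite -(scale0r 0) bilinZr scale0r. Qed.

Lemma bilin_suml (J : Type) (s : seq J) (F : J -> B) y :
  phi (\sum_(j <- s) F j) y = \sum_(j <- s) phi (F j) y.
Proof.
by case: hphi => hD _; apply: (big_morph (phi^~ y)) => [x x'|]; [exact: hD | exact: bilin0l].
Qed.

Lemma bilin_sumr (J : Type) (s : seq J) (F : J -> M) x :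
  phi x (\sum_(j <- s) F j) = \sum_(j <- s) phi x (F j).
Proof.
by case: hphi => _ [hD _]; apply: (big_morph (phi x)) => [y y'|]; [exact: hD | exact: bilin0r].
Qed.

Lemma bilin_vanW (N' : M -> Prop) : (forall y, N' y -> N y) -> bilin_van N' phi.
Proof.
case: hphi => h1 [h2 [h3 [h4 h5]]] NN'.
by do 4!(split; first by []); move=> x y /NN'; exact: h5.
Qed.

Lemma bilin_van0 : bilin_van (fun y => y = 0) phi.
Proof.
case: hphi => h1 [h2 [h3 [h4 h5]]].
by do 4!(split; first by []); move=> x y ->; exact: bilin0r.
Qed.

Lemma bilin_comp (A : lmodType R) (f : {linear A -> B}) : bilin_van N (fun x => phi (f x)).
Proof.
case: hphi => [h1 [h2 [h3 [h4 h5]]]].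
split=> [x x' y|]; first by rewrite linearD.
split; first by move=> x y z; exact: h2.
split=> [r x y|]; first by rewrite linearZ; exact: h3.
by split=> [r x y|x y Ny]; [exact: h4 | exact: h5].
Qed.

End Bilinear.

Section Presentation.
Variables (R : comNzRingType) (B M : lmodType R) (p q : nat).
Variables (b : 'I_p -> B) (m : 'I_q -> M).
Hypothesis hb : forall x, exists c : 'I_p -> R, x = \sum_(i < p) c i *: b i.
Hypothesis hm : forall y, exists c : 'I_q -> R, y = \sum_(j < q) c j *: m j.

(* A matrix [c] stands for the tensor [\sum_(i, j) c i j (b i ⊗ m j)]; [tensor_eval phi c] is
   its image under the linear map induced by the bilinear map [phi]. *)
Definition tensor_eval (W : lmodType R) (phi : B -> M -> W) (c : 'M[R]_(p, q)) : W :=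
  \sum_(i < p) \sum_(j < q) c i j *: phi (b i) (m j).

Lemma tensor_evalD (W : lmodType R) (phi : B -> M -> W) c d :
  tensor_eval phi (c + d) = tensor_eval phi c + tensor_eval phi d.
Proof.
rewrite -big_split; apply: eq_bigr => i _; rewrite -big_split; apply: eq_bigr => j _.
by rewrite mxE scalerDl.
Qed.

Lemma tensor_evalZ (W : lmodType R) (phi : B -> M -> W) r c :
  tensor_eval phi (r *: c) = r *: tensor_eval phi c.
Proof.
rewrite scaler_sumr; apply: eq_bigr => i _; rewrite scaler_sumr; apply: eq_bigr => j _.
by rewrite mxE scalerA.
Qed.

Lemma tensor_eval0 (W : lmodType R) (phi : B -> M -> W) : tensor_eval phi 0 = 0.
Proof. by rewrite -(scale0r (0 : 'M[R]_(p, q))) tensor_evalZ scale0r. Qed.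

Lemma tensor_evalB (W : lmodType R) (phi : B -> M -> W) c d :
  tensor_eval phi (c - d) = tensor_eval phi c - tensor_eval phi d.
Proof. by rewrite tensor_evalD -(scaleN1r d) tensor_evalZ scaleN1r. Qed.

Lemma tensor_eval_sum (W : lmodType R) (phi : B -> M -> W) (J : Type) (s : seq J)
  (F : J -> 'M[R]_(p, q)) :
  tensor_eval phi (\sum_(k <- s) F k) = \sum_(k <- s) tensor_eval phi (F k).
Proof.
by apply: (big_morph (tensor_eval phi)) => [c d|]; [exact: tensor_evalD | exact: tensor_eval0].
Qed.

(** The entries are products of chosen coordinates. The choice need not be additive, so [t] itself
    need not be bilinear, but every bilinear map evaluates [t x y] as it does the pure tensor of [x]
    and [y]. *)
Lemma pure_tensor_exists : exists t : B -> M -> 'M[R]_(p, q),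
  forall (W : lmodType R) (phi : B -> M -> W) N, bilin_van N phi ->
  forall x y, tensor_eval phi (t x y) = phi x y.
Proof.
have /choice [be hbe] := hb; have /choice [mu hmu] := hm.
exists (fun x y => \matrix_(i, j) (be x i * mu y j)) => W phi N hphi x y.
rewrite [in RHS](hbe x) (bilin_suml hphi); apply: eq_bigr => i _.
rewrite [in RHS](hmu y) (bilin_sumr hphi); apply: eq_bigr => j _.
by rewrite mxE (bilinZl hphi) (bilinZr hphi) scalerA.
Qed.

Lemma tensor_matrix (z : seq (B * M)) : exists c : 'M[R]_(p, q),
  forall (W : lmodType R) (phi : B -> M -> W) N, bilin_van N phi ->
    \sum_(x <- z) phi x.1 x.2 = tensor_eval phi c.
Proof.
have [t ht] := pure_tensor_exists.
exists (\sum_(x <- z) t x.1 x.2) => W phi N hphi.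
by rewrite tensor_eval_sum; apply: eq_bigr => x _; rewrite (ht _ _ N).
Qed.

Lemma matrix_tensor (c : 'M[R]_(p, q)) : exists z : seq (B * M),
  forall (W : lmodType R) (phi : B -> M -> W) N, bilin_van N phi ->
    \sum_(x <- z) phi x.1 x.2 = tensor_eval phi c.
Proof.
exists [seq (c ij.1 ij.2 *: b ij.1, m ij.2) | ij <- enum [set: 'I_p * 'I_q]].
move=> W phi N hphi; rewrite big_map big_enum /=.
rewrite /tensor_eval pair_bigA /=; apply: eq_big => [ij | ij _]; first by rewrite inE.
by rewrite (bilinZl hphi).
Qed.

Variables (A C : lmodType R) (al : {linear A -> B}) (be : {linear B -> C}).

(** One [w] has to serve all test maps, which makes this an equality in the tensor product with
    [M / N]. For [N = 0] it is the submodule [K] of the overview. *)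
Definition boundary_mx (N : M -> Prop) (c : 'M[R]_(p, q)) : Prop :=
  exists w : seq (A * M), forall (W : lmodType R) (phi : B -> M -> W), bilin_van N phi ->
    tensor_eval phi c = \sum_(x <- w) phi (al x.1) x.2.

Definition cycle_mx (N : M -> Prop) (c : 'M[R]_(p, q)) : Prop :=
  forall (W : lmodType R) (phi : C -> M -> W), bilin_van N phi ->
    tensor_eval (fun x => phi (be x)) c = 0.

Lemma boundary_mx_submod N : submod (boundary_mx N).
Proof.
split; first by exists [::] => W phi _; rewrite big_nil tensor_eval0.
split=> [c d [w hw] [v hv] | r c [w hw]].
  by exists (w ++ v) => W phi hphi; rewrite tensor_evalD big_cat hw // hv.
exists (tscale r w) => W phi hphi; rewrite tensor_evalZ hw // big_map scaler_sumr.
by apply: eq_bigr => x _ /=; rewrite linearZ (bilinZl hphi).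
Qed.

Lemma cycle_mx_submod N : submod (cycle_mx N).
Proof.
split=> [W phi _|]; first exact: tensor_eval0.
split=> [c d hc hd W phi hphi | r c hc W phi hphi].
  by rewrite tensor_evalD hc // hd // addr0.
by rewrite tensor_evalZ hc // scaler0.
Qed.

Lemma is_cycleE N (z : seq (B * M)) c :
  (forall (W : lmodType R) (phi : B -> M -> W), bilin_van N phi ->
    \sum_(x <- z) phi x.1 x.2 = tensor_eval phi c) ->
  is_cycle be N z <-> cycle_mx N c.
Proof.
move=> hz; split=> h W phi hphi.
  by rewrite -hz; [have := h W phi hphi; rewrite big_map | exact: bilin_comp].
by rewrite big_map /= (hz _ (fun x => phi (be x))); [exact: h | exact: bilin_comp].
Qed.

Lemma hom_annE N (z : seq (B * M)) c r :
  (forall (W : lmodType R) (phi : B -> M -> W), bilin_van N phi ->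
    \sum_(x <- z) phi x.1 x.2 = tensor_eval phi c) ->
  hom_ann al N z r <-> boundary_mx N (r *: c).
Proof.
move=> hz.
have eqw w (W : lmodType R) (phi : B -> M -> W) : bilin_van N phi ->
    \sum_(x <- tsub (tscale r z) (tmap al w)) phi x.1 x.2 =
    tensor_eval phi (r *: c) - \sum_(x <- w) phi (al x.1) x.2.
  move=> hphi; rewrite big_cat !big_map /= tensor_evalZ -hz // scaler_sumr -sumrN.
  congr (_ + _); apply: eq_bigr => x _; first by rewrite (bilinZl hphi).
  by rewrite -scaleN1r (bilinZl hphi) scaleN1r.
split=> [] [w hw]; exists w => W phi hphi.
  by apply/eqP; rewrite -subr_eq0 -eqw //; apply/eqP; exact: hw.
by rewrite eqw // hw // subrr.
Qed.

(** For the direct implication, [G / (K + I^n G)] is itself the target of a bilinear map that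
    vanishes on [I^n M]. Testing [w] against this map shows that the class of [c] is zero. *)
Lemma boundary_mx_pow (I : R -> Prop) n c :
  boundary_mx (ideal_pow_smul I n (M := M)) c <->
  subadd (boundary_mx (fun y => y = 0)) (ideal_pow_smul I n (M := 'M[R]_(p, q))) c.
Proof.
set N := ideal_pow_smul I n (M := M).
set K := boundary_mx (fun y => y = 0); have hK : submod K := boundary_mx_submod _.
have hP := ideal_pow_submod I 'M[R]_(p, q) n.
have hS := submod_add hK hP.
split; last first.
  apply: subadd_min => [|d [w hw]|_ [k [a [v [ha ->]]]]]; first exact: boundary_mx_submod.
    by exists w => W phi hphi; apply: hw; exact: bilin_van0 hphi.
  exists [::] => W phi hphi; rewrite big_nil tensor_eval_sum big1 // => j _.
  rewrite tensor_evalZ scaler_sumr big1 // => i _; rewrite scaler_sumr big1 // => l _.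
  rewrite scalerA mulrC -scalerA -(bilinZr hphi).
  case: hphi => _ [_ [_ [_ ->]]]; rewrite ?scaler0 //.
  by exists 1%N, (fun _ => a j), (fun=> m l); rewrite big_ord1.
move=> [w hw].
have [t ht] := pure_tensor_exists.
have K0 d : (forall (W : lmodType R) (phi : B -> M -> W), bilin_van (fun y => y = 0) phi ->
    tensor_eval phi d = 0) -> K d.
  by move=> hd; exists [::] => W phi hphi; rewrite big_nil hd.
pose phi x y : quotmod hS := qclass hS (t x y).
(* Matrices that no bilinear map distinguishes differ by an element of [K], with the empty list as
   boundary; modulo [K], therefore, [t] becomes bilinear. *)
have eqK d d' : (forall (W : lmodType R) (psi : B -> M -> W), bilin_van (fun y => y = 0) psi ->
    tensor_eval psi d = tensor_eval psi d') -> qclass hS d = qclass hS d'.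
  move=> hd; apply/qclass_eq; apply: subaddl => //; apply: K0 => W psi hpsi.
  by rewrite tensor_evalB hd // subrr.
have hphi : bilin_van N phi.
  split=> [x x' y|].
    rewrite -qclassD; apply: eqK => W psi hpsi.
    by rewrite tensor_evalD !(ht _ _ _ hpsi); case: hpsi.
  split=> [x y y'|].
    rewrite -qclassD; apply: eqK => W psi hpsi.
    by rewrite tensor_evalD !(ht _ _ _ hpsi); case: hpsi => _ [].
  split=> [r x y|].
    rewrite -qclassZ; apply: eqK => W psi hpsi.
    by rewrite tensor_evalZ !(ht _ _ _ hpsi) (bilinZl hpsi).
  split=> [r x y|x y [k [a [v [ha ->]]]]].
    rewrite -qclassZ; apply: eqK => W psi hpsi.
    by rewrite tensor_evalZ !(ht _ _ _ hpsi) (bilinZr hpsi).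
  rewrite /phi (eqK _ (\sum_(j < k) (\prod_(l < n) a j l) *: t x (v j))).
    by apply/(qclass_eq0 hS); apply: subaddr => //; exists k, a, (fun j => t x (v j)).
  move=> W psi hpsi; rewrite (ht _ _ _ hpsi) (bilin_sumr hpsi) tensor_eval_sum.
  apply: eq_bigr => j _.
  by rewrite tensor_evalZ (ht _ _ _ hpsi) (bilinZr hpsi).
have eqc : qclass hS c = tensor_eval phi c.
  have -> : tensor_eval phi c =
      qclass hS (\sum_(i < p) \sum_(j < q) c i j *: t (b i) (m j)).
    rewrite qclass_sum; apply: eq_bigr => i _; rewrite qclass_sum; apply: eq_bigr => j _.
    by rewrite qclassZ.
  apply: eqK => W psi hpsi; rewrite tensor_eval_sum; apply: eq_bigr => i _.
  rewrite tensor_eval_sum; apply: eq_bigr => j _.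
  by rewrite tensor_evalZ (ht _ _ _ hpsi).
apply/(qclass_eq0 hS); rewrite eqc hw // big1 // => x _.
apply/(qclass_eq0 hS); apply: subaddl => //.
by exists [:: x] => W psi hpsi; rewrite big_seq1 (ht _ _ _ hpsi).
Qed.

End Presentation.


(** * The zero ideal, and the passage from the functor to the filtration *)

Lemma ideal_pow_smul_zero (R : comNzRingType) (I : R -> Prop) (M : lmodType R) n :
  (forall a, I a -> a = 0) -> ideal_pow_smul I n.+1 (M := M) = (fun y => y = 0).
Proof.
move=> I0; apply/funext => y; apply: propext; split=> [|->].
  apply: (@ideal_powS_min R I M n (fun y => y = 0)) => [|a x /I0 -> _]; last first.
    by rewrite scale0r.
  by split=> //; split=> [x z -> ->|r x ->]; rewrite ?addr0 ?scaler0.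
by exists 0%N, (fun _ _ => 0), (fun=> 0); split=> [[]//|]; rewrite big_ord0.
Qed.

Theorem theorem5p6 (R : idomainType) (A B C : lmodType R)
  (al : {linear A -> B}) (be : {linear B -> C})
  (M : lmodType R) (I : R -> Prop) :
  noetherian_ring R -> krull_dim_one R -> is_ideal I ->
  (forall a, be (al a) = 0) -> module_fg B -> module_fg M ->
  exists n0 : nat, (1 <= n0)%N /\
    forall n : nat, (n0 <= n)%N ->
      forall P : R -> Prop,
        Ass_F al be (ideal_pow_smul I n (M:=M)) P <->
        Ass_F al be (ideal_pow_smul I n0 (M:=M)) P.
Proof.
move=> hR hdim hI hab [p [b hb]] [q [m hm]].
(* If [I] is zero, then [I^n M = 0] for all [n >= 1], and the sequence is constant from 1 on. *)
have [[a0 [Ia0 a00]] | hno] := EM (exists a, I a /\ a <> 0); last first.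
  exists 1%N; split=> // -[//|n] _ P; rewrite !ideal_pow_smul_zero // => a Ia.
  - by apply: contrapT => a0; apply: hno; exists a.
  - by apply: contrapT => a0; apply: hno; exists a.
pose K := boundary_mx b m al (fun y => y = 0).
pose W n := cycle_mx b m be (ideal_pow_smul I n (M := M)).
have hK : submod K by exact: boundary_mx_submod.
have hW n : submod (W n) by exact: cycle_mx_submod.
have AssE n P : Ass_F al be (ideal_pow_smul I n (M := M)) P <-> filtration_ass I K W n P.
  split=> [[hP [z [hz hPz]]] | [hP [c [hc hPc]]]]; split=> //.
    have [c hzc] := tensor_matrix hb hm z.
    exists c; split; first by apply/(is_cycleE be (fun V phi => hzc V phi _)).
    move=> r; rewrite hPz (hom_annE _ _ (fun V phi => hzc V phi _)).
    by rewrite boundary_mx_pow.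
  have [z hzc] := matrix_tensor b m c.
  exists z; split; first by apply/(is_cycleE be (fun V phi => hzc V phi _)).
  move=> r; rewrite hPc (hom_annE _ _ (fun V phi => hzc V phi _)).
  by rewrite boundary_mx_pow.
have W_dec n c : W n.+1 c -> W n c.
  move=> hc V phi hphi; apply: hc; apply: (bilin_vanW hphi) => y.
  exact: ideal_pow_leq.
have W_sub n c : subadd K (ideal_pow_smul I n (M := 'M[R]_(p, q))) c -> W n c.
  rewrite -boundary_mx_pow // => -[w hw] V phi hphi.
  rewrite (hw _ (fun x => phi (be x))); last exact: bilin_comp.
  by apply: big1 => x _; rewrite hab; exact: (bilin0l hphi).
have W_mul n a c : I a -> W n c -> W n.+1 (a *: c).
  move=> Ia hc V phi hphi; have [h1 [h2 [h3 [h4 h5]]]] := hphi.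
  (* Composing with multiplication by [a] turns a map that vanishes on [I^(n+1) M] into one that
     vanishes on [I^n M], against which the cycle [c] can be tested. *)
  have hphi' : bilin_van (ideal_pow_smul I n (M := M)) (fun x y => phi x (a *: y)).
    split=> [x x' y|]; first exact: h1.
    split=> [x y y'|]; first by rewrite scalerDr h2.
    split=> [r x y|]; first exact: h3.
    split=> [r x y|x y hy]; last by apply: h5; exact: ideal_powSM.
    by rewrite scalerA mulrC -scalerA h4.
  rewrite tensor_evalZ -[RHS](hc V _ hphi') scaler_sumr; apply: eq_bigr => i _.
  rewrite scaler_sumr; apply: eq_bigr => j _.
  by rewrite h4 !scalerA mulrC.
have [n0 [n01 h]] := filtration_ass_stable hR hdim hI Ia0 a00 (noeth_matrix hR) hK hW
  W_dec W_sub W_mul.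
by exists n0; split=> // n hn P; rewrite !AssE; exact: h.
Qed.
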